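(* For every integer $n\geq 2$, $\Delta(\mathcal{K}_{1}^{n})\leq 2^{n-2}+1-n$, i.e., $s(\mathcal{K}_{1}^{n})\geq 3\cdot 2^{n-2}-2$.
   Context: Real universal complex: for $n\ge 1$, $\mathcal{K}_{1}^{n}$ is the simplicial complex whose vertices are the primitive (i.e. nonzero) vectors of $\mathbb{Z}_2^n$ (where $\mathbb{Z}_2=\mathbb{Z}/2$), so it has $2^n-1$ vertices, and in which a set of vertices $\{v_1,\dots,v_k\}$ is a simplex if and only if it is part of a basis of $\mathbb{Z}_2^n$. Moment-angle complexes: let $K$ be a simplicial complex on $[m]=\{1,\dots,m\}$. For a pair $A\subseteq X$ and $I\subseteq[m]$ put $(X,A)^I=\{(x_1,\dots,x_m)\in X^m : x_i\in A \text{ if } i\notin I\}$. Let $D^1=[-1,1]$, $S^0=\{-1,1\}$, $D^2=\{z\in\mathbb{C}:|z|\le 1\}$, $S^1=\partial D^2$. Define $\mathbb{R}\mathcal{Z}_K=\bigcup_{I\in K}(D^1,S^0)^I\subseteq (D^1)^m$ and $\mathcal{Z}_K=\bigcup_{I\in K}(D^2,S^1)^I\subseteq (D^2)^m$. The group $\mathbb{Z}_2^m$ acts on $\mathbb{R}\mathcal{Z}_K$ by coordinatewise sign changes, and the torus $T^m=(S^1)^m$ acts on $\mathcal{Z}_K$ by coordinatewise rotation. Buchstaber invariants: the real Buchstaber invariant $s_{\mathbb{R}}(K)$ is the maximal rank of a subgroup $H\subseteq\mathbb{Z}_2^m$ whose restricted action on $\mathbb{R}\mathcal{Z}_K$ is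 free. The Buchstaber invariant $s(K)$ is the maximal rank of a toric subgroup $G\subseteq T^m$ (a closed subgroup isomorphic to a torus $T^r$; its rank is $r$) whose restricted action on $\mathcal{Z}_K$ is free. Put $\Delta(K)=s_{\mathbb{R}}(K)-s(K)$. It is known that $s_{\mathbb{R}}(\mathcal{K}_1^n)=2^n-1-n$, so $s(\mathcal{K}_1^n)+\Delta(\mathcal{K}_1^n)=2^n-1-n$. *)

(* Defs.v *)
From HB Require Import structures.
From mathcomp Require Import all_boot all_order all_algebra.
From mathcomp Require Import all_fingroup all_solvable.
From mathcomp Require Import all_classical all_reals all_analysis.
From mathcomp Require Import complex.
Set Implicit Arguments.
Unset Strict Implicit.
Unset Printing Implicit Defensive.
Import Order.TTheory GRing.Theory Num.Theory.
Import numFieldNormedType.Exports.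
Local Open Scope classical_set_scope.
Local Open Scope ring_scope.

(* Simplicial complexes on a finite index set V (in place of {1, ..., m}).
   As usual for complexes "on [m]", elements of V need not be vertices. *)
Record scomplex (V : finType) := SComplex {
  faces :> {set {set V}} ;
  face0 : finset.set0 \in faces ;
  faceS : forall I J : {set V}, J \subset I -> I \in faces -> J \in faces
}.

(* The union over I in K of (X, A)^I, as a set of families indexed by V. *)
Definition polyprod (V : finType) (K : scomplex V) (T : Type) (X A : set T) :
    set (V -> T) :=
  [set x | exists2 I : {set V}, I \in faces K &
    (forall v, X (x v)) /\ (forall v, v \notin I -> A (x v))].

Definition free_action (G Y : Type) (e : G) (act : G -> Y -> Y)
    (H : set G) (X : set Y) : Prop :=
  forall g x, H g -> X x -> act g x = x -> g = e.

Definition is_max (P : set nat) (r : nat) : Prop :=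
  P r /\ forall s, P s -> (s <= r)%N.

(* The maximum of P (0 if there is none). *)
Definition max_nat (P : set nat) : nat := xget 0%N [set r | is_max P r].

Lemma max_natP (P : set nat) (b : nat) :
  P 0%N -> (forall r, P r -> (r <= b)%N) -> is_max P (max_nat P).
Proof.
move=> P0 Pb; suff [r Mr] : exists r, is_max P r.
  exact: (@xgetPex _ 0%N [set r | is_max P r] (ex_intro _ r Mr)).
have exP : exists r, `[< P r >] by exists 0%N; apply/asboolP.
have ubP r : `[< P r >] -> (r <= b)%N by move/asboolP/Pb.
case: (ex_maxnP exP ubP) => r /asboolP Pr maxr.
by exists r; split=> // s /asboolP/maxr.
Qed.

(* The join of the library's pointwise group structure with finiteness; since
   'F_2 is a group for +, so is Z_2^V = {ffun V -> 'F_2}. *)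
HB.instance Definition _ (V : finType) (G : finGroupType) :=
  Group.on {ffun V -> G}.

Section RealBuchstaber.
Variables (R : realType) (V : finType).

Definition D1 : set R := [set x | -1 <= x <= 1].
Definition S0 : set R := [set x | x = -1 \/ x = 1].

Definition real_moment_angle (K : scomplex V) : set (V -> R) := polyprod K D1 S0.

Definition sign_act (h : {ffun V -> 'F_2}) (x : V -> R) : V -> R :=
  fun v => (-1) ^+ h v * x v.

Definition real_free_rank (K : scomplex V) (r : nat) : Prop :=
  exists H : {group {ffun V -> 'F_2}},
    'r(H)%g = r /\ free_action 0 sign_act [set` H] (real_moment_angle K).

Definition real_buchstaber (K : scomplex V) : nat := max_nat (real_free_rank K).

Lemma real_free_rank0 K : real_free_rank K 0.
Proof.
exists 1%G; split; first exact: rank1.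
by move=> g x /= /set1gP.
Qed.

Lemma rank_Z2V_le (H : {group {ffun V -> 'F_2}}) : ('r(H)%g <= #|V|)%N.
Proof.
case: (rank_witness H) => p p_pr ->; apply: leq_trans (p_rank_le_logn p H) _.
have cT : #|{ffun V -> 'F_2}| = (2 ^ #|V|)%N by rewrite card_ffun card_Fp.
have dH : (#|H| %| 2 ^ #|V|)%N.
  by have := cardSg (finset.subsetT H); rewrite cardsT /= cT.
apply: leq_trans (dvdn_leq_log p _ dH) _; first by rewrite expn_gt0.
by rewrite lognX logn_prime //; case: eqP => _; rewrite ?muln1 ?muln0.
Qed.

Lemma real_buchstaber_max K : is_max (real_free_rank K) (real_buchstaber K).
Proof.
apply: max_natP (real_free_rank0 K) _ => r [H [<- _]]; exact: rank_Z2V_le.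
Qed.

End RealBuchstaber.

Section Buchstaber.
Variables (R : realType).

(* The regular module on R[i] carries the norm topology. *)
Local Notation C := (R[i])^o.

Definition D2 : set C := [set z | `|z| <= 1].
Definition S1 : set C := [set z | `|z| = 1].

Definition torus (I : finType) : set {ptws I -> C} :=
  [set t | forall i, S1 (t i)].
Arguments torus I : clear implicits.

Definition tone (I : finType) : {ptws I -> C} := fun=> 1.
Arguments tone I : clear implicits.
Definition tmul (I : finType) (s t : {ptws I -> C}) : {ptws I -> C} :=
  fun i => s i * t i.
Definition tinv (I : finType) (t : {ptws I -> C}) : {ptws I -> C} :=
  fun i => (t i)^-1.

Definition closed_subgroup (V : finType) (G : set {ptws V -> C}) : Prop :=
  [/\ G `<=` torus V, G (tone V),
      (forall s t, G s -> G t -> G (tmul s t)),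
      (forall t, G t -> G (tinv t)) & closed G].

(* G, with the subspace topology, is isomorphic to T^r as a topological
   group: f and g are mutually inverse continuous maps. *)
Definition isog_torus (V : finType) (r : nat) (G : set {ptws V -> C}) : Prop :=
  exists (f : {ptws 'I_r -> C} -> {ptws V -> C})
         (g : {ptws V -> C} -> {ptws 'I_r -> C}),
    [/\ (forall t, torus 'I_r t -> G (f t) /\ g (f t) = t),
        (forall t, G t -> torus 'I_r (g t) /\ f (g t) = t),
        (forall s t, torus 'I_r s -> torus 'I_r t ->
           f (tmul s t) = tmul (f s) (f t)),
        {within torus 'I_r, continuous f} & {within G, continuous g}].

Variable V : finType.

Definition moment_angle (K : scomplex V) : set (V -> C) := polyprod K D2 S1.

Definition rot_act (t : {ptws V -> C}) (x : V -> C) : V -> C :=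
  fun v => t v * x v.

Definition free_rank (K : scomplex V) (r : nat) : Prop :=
  exists G : set {ptws V -> C},
    [/\ closed_subgroup G, isog_torus r G &
        free_action (tone V) rot_act G (moment_angle K)].

Definition buchstaber (K : scomplex V) : nat := max_nat (free_rank K).

Lemma free_rank0 K : free_rank K 0.
Proof.
exists [set tone V]; split.
- split.
  + by move=> _ -> i; rewrite /S1 /= normr1.
  + by [].
  + by move=> _ _ -> ->; apply/funext => i; rewrite /tmul mulr1.
  + by move=> _ ->; apply/funext => i; rewrite /tinv invr1.
  + apply: accessible_closed_set1; apply: hausdorff_accessible.
    apply: hausdorff_product => _; exact: norm_hausdorff.
- exists (fun=> tone V), (fun=> tone 'I_0); split.
  + by move=> t _; split=> //; apply/funext => -[].
  + by move=> _ ->; split=> // -[].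
  + by move=> *; apply/funext => i; rewrite /tmul mulr1.
  + by move=> ?; exact: cst_continuous.
  + by move=> ?; exact: cst_continuous.
- by move=> g x ->.
Qed.

(* Compare the 2-torsion of T^r and of T^V. *)
Lemma isog_torus_le r (G : set {ptws V -> C}) :
  G `<=` torus V -> isog_torus r G -> (r <= #|V|)%N.
Proof.
move=> GT [f [g [fK gK fM _ _]]].
pose e (h : {ffun 'I_r -> bool}) : {ptws 'I_r -> C} := fun i => (-1) ^+ h i.
have eT h : torus 'I_r (e h) by move=> i; rewrite /S1 /= normr_sign.
have ee h : tmul (e h) (e h) = tone 'I_r.
  by apply/funext => i; rewrite /tmul /e -expr2 sqrr_sign.
have T1 : torus 'I_r (tone 'I_r) by move=> i; rewrite /S1 /= normr1.
have f1 : f (tone 'I_r) = tone V.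
  apply/funext => v; have := fM _ _ T1 T1.
  have -> : tmul (tone 'I_r) (tone 'I_r) = tone 'I_r :> {ptws 'I_r -> C}.
    by apply/funext => i; rewrite /tmul mulr1.
  move=> /(congr1 (@^~ v)); rewrite /tmul => E.
  have nz : f (tone 'I_r) v != 0.
    have := GT _ (fK _ T1).1 v; rewrite /S1 /= => n1.
    by rewrite -normr_gt0 n1.
  by apply: (mulfI nz); rewrite -E mulr1.
have fe h v : f (e h) v = 1 \/ f (e h) v = -1.
  have /(congr1 (@^~ v)) := fM _ _ (eT h) (eT h).
  rewrite ee f1 /tmul /tone -expr2 => /esym/eqP; rewrite sqrf_eq1.
  by case/orP => /eqP; [left|right].
pose k (h : {ffun 'I_r -> bool}) : {ffun V -> bool} :=
  [ffun v => f (e h) v == -1].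
have N1 : (1 : C) != -1 by rewrite eq_sym eqNr oner_eq0.
have k_inj : injective k.
  move=> h1 h2 /ffunP k12.
  have E : f (e h1) = f (e h2).
    apply/funext => v; have := k12 v; rewrite !ffunE.
    by case: (fe h1 v) => ->; case: (fe h2 v) => -> //;
      rewrite eqxx ?(negPf N1).
  have {}E : e h1 = e h2 by rewrite -[LHS](fK _ (eT _)).2 E (fK _ (eT _)).2.
  apply/ffunP => i; have := congr1 (@^~ i) E; rewrite /e.
  by case: (h1 i); case: (h2 i) => // /eqP; rewrite expr0 expr1 ?(negPf N1) //
    eq_sym (negPf N1).
have := leq_card _ k_inj; rewrite !card_ffun card_bool card_ord.
by rewrite leq_exp2l.
Qed.

Lemma buchstaber_max K : is_max (free_rank K) (buchstaber K).
Proof.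
apply: max_natP (free_rank0 K) _ => r [G [[GT _ _ _ _] Giso _]].
exact: isog_torus_le GT Giso.
Qed.

Definition Delta (K : scomplex V) : int :=
  (real_buchstaber R K)%:Z - (buchstaber K)%:Z.

End Buchstaber.

Notation nzvec n := {v : 'rV['F_2]_n | v != 0}.

Section UniversalComplex.
Variable n : nat.

(* Every basis of Z_2^n has n elements, so n-tuples suffice. *)
Definition part_of_basis (I : {set nzvec n}) : bool :=
  [exists b : n.-tuple 'rV['F_2]_n,
     basis_of {: 'rV['F_2]_n} b && [forall v in I, val v \in b]].

Definition universal_faces : {set {set nzvec n}} :=
  [set I : {set nzvec n} | part_of_basis I]%SET.

Lemma universal_face0 : finset.set0 \in universal_faces.
Proof.
rewrite inE; apply/existsP.
have dn : \dim {: 'rV['F_2]_n} = n by rewrite dimvf /dim /= mul1n.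
exists (tcast dn (vbasis {: 'rV['F_2]_n})); rewrite val_tcast vbasisP /=.
by apply/forallP => v; rewrite inE.
Qed.

Lemma universal_faceS (I J : {set nzvec n}) :
  J \subset I -> I \in universal_faces -> J \in universal_faces.
Proof.
move=> /fintype.subsetP JI; rewrite !inE => /existsP[b /andP[bb /forall_inP bI]].
by apply/existsP; exists b; rewrite bb; apply/forall_inP => v /JI/bI.
Qed.

Definition universal_complex : scomplex (nzvec n) :=
  SComplex universal_face0 universal_faceS.

End UniversalComplex.

(* Main.v *)
(** Index the vectors of F_2^n, n = k + 2, by triples (b, c, u) with b, c in F_2
and u in F_2^k, and send (b, c, u) to the integer vector whose coordinates are
[a . u + b] in {0, 1}, for a in F_2^k, followed by [c]: this is a map to Z^l
with l = 2^k + 1.  If the integer matrix M with these columns is injective on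
the subtorus supported on each simplex, then its kernel acts freely on the
moment-angle complex; the kernel need not be connected, but by the Smith normal
form of M it contains a torus of rank m - l = 3 * 2^k - 2, where m = 2^n - 1.

For injectivity, let x be an element of the kernel, written additively and
supported on an independent set.  A Fourier transform over a shows that, up to
a power of 2, the sums y_u = x(0,0,u) + x(0,1,u) and x(1,0,u) + x(1,1,u) agree
for every u (for u = 0 after giving the zero vector (0,0,0) a suitable weight),
and that the y_u add up to 0.  The support together with 0 is affinely
independent, so at most two y_u are nonzero, and in each case the last
coordinate forces x to vanish.  What remains is killed by a power of 2, and
there M is injective because its rows span F_2^n modulo 2.

In the real case, a subgroup acting freely meets the coordinate subgroup of an
n-element simplex trivially, hence has rank at most m - n. *)

Require Import Defs.
From HB Require Import structures.
From mathcomp Require Import all_boot all_order all_algebra.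
From mathcomp Require Import all_fingroup all_solvable.
From mathcomp Require Import all_classical all_reals all_analysis.
From mathcomp Require Import complex zify.
Set Implicit Arguments.
Unset Strict Implicit.
Unset Printing Implicit Defensive.
Import Order.TTheory GRing.Theory Num.Theory.
Import numFieldNormedType.Exports.
Local Open Scope ring_scope.

(** * Monomial maps between tori, and Smith normal form *)

Section MonomialMaps.
Variable F : fieldType.
Implicit Types (I J L : finType).

(** The homomorphism of split tori with exponent matrix [A]; composition becomes the matrix
    product. *)
Definition monomial I J (A : J -> I -> int) (t : I -> F) : J -> F :=
  fun j => \prod_i t i ^ A j i.

Lemma expfz_sum I (A : I -> int) (x : F) :
  x != 0 -> x ^ (\sum_i A i) = \prod_i x ^ A i.
Proof.
move=> x0; rewrite (big_morph (fun k : int => x ^ k) (id1 := 1) (op1 := *%R)) //.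
by move=> a b; rewrite expfzDr.
Qed.

Lemma prod_expfz I (f : I -> F) (k : int) :
  (\prod_i f i) ^ k = \prod_i f i ^ k.
Proof.
rewrite (big_morph (fun x : F => x ^ k) (id1 := 1) (op1 := *%R)) //.
  by move=> x y; rewrite expfzMl.
exact: exp1rz.
Qed.

Lemma monomial_comp I J L (A : J -> I -> int) (B : I -> L -> int) (t : L -> F) :
  (forall l, t l != 0) ->
  monomial A (monomial B t) =1 monomial (fun j l => \sum_i A j i * B i l) t.
Proof.
move=> t0 j; rewrite /monomial.
under eq_bigr do rewrite prod_expfz.
rewrite exchange_big /=; apply: eq_bigr => l _; rewrite expfz_sum //.
by apply: eq_bigr => i _; rewrite exprz_exp mulrC.
Qed.

Lemma monomial_mul I J (A : J -> I -> int) (s t : I -> F) j :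
  monomial A (fun i => s i * t i) j = monomial A s j * monomial A t j.
Proof. by rewrite /monomial -big_split; under eq_bigr do rewrite expfzMl. Qed.

Lemma monomial_inv I J (A : J -> I -> int) (t : I -> F) j :
  monomial A (fun i => (t i)^-1) j = (monomial A t j)^-1.
Proof.
by rewrite /monomial -prodfV; under eq_bigr do rewrite exprz_inv -invr_expz.
Qed.

Lemma monomial_one I J (A : J -> I -> int) j : monomial A (fun=> 1) j = 1.
Proof. by rewrite /monomial big1 // => i _; rewrite exp1rz. Qed.

Lemma monomial_delta I J (h : J -> I) (t : I -> F) j :
  monomial (fun j i => (h j == i)%:R) t j = t (h j).
Proof.
rewrite /monomial (bigD1 (h j)) //= eqxx expr1z big1 ?mulr1 // => i ne.
by rewrite eq_sym (negPf ne) expr0z.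
Qed.

Lemma eq_monomial I J (A B : J -> I -> int) (t : I -> F) j :
  A j =1 B j -> monomial A t j = monomial B t j.
Proof. by move=> AB; apply: eq_bigr => i _; rewrite AB. Qed.

End MonomialMaps.

(** In the Smith form [L D Z], take [P = Z], [Q] its inverse and [N = L D]. As [D] is diagonal with
    [#|J|] rows, its columns from index [#|J|] on vanish; these form [A]. *)
Lemma smith_factor (V J : finType) (M : J -> V -> int) :
  exists (A : {set V}) (P Q : V -> V -> int) (N : J -> V -> int),
  [/\ (#|V| <= #|A| + #|J|)%N,
      forall u w, \sum_v P u v * Q v w = (u == w)%:R,
      forall u w, \sum_v Q u v * P v w = (u == w)%:R,
      forall j u, u \in A -> N j u = 0 &
      forall j v, M j v = \sum_u N j u * P u v].
Proof.
pose M' : 'M[int]_(#|J|, #|V|) := \matrix_(i, j) M (enum_val i) (enum_val j).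
have [L Lu [Z Zu [d _ defM]]] := int_Smith_normal_form M'.
pose D : 'M[int]_(#|J|, #|V|) := \matrix_(i, j) (d`_i *+ (i == j :> nat)).
rewrite -/D in defM.
have sumV (h : 'I_#|V| -> int) : \sum_(v : V) h (enum_rank v) = \sum_i h i.
  rewrite (reindex (@enum_val V predT)); last exact: onW_bij (enum_val_bij V).
  by apply: eq_bigr => i _; rewrite enum_valK.
have rank_eq (u w : V) : (enum_rank u == enum_rank w) = (u == w).
  exact: inj_eq enum_rank_inj _ _.
exists [set v : V | (#|J| <= enum_rank v)%N].
exists (fun u v => Z (enum_rank u) (enum_rank v)).
exists (fun u v => invmx Z (enum_rank u) (enum_rank v)).
exists (fun j u => (L *m D) (enum_rank j) (enum_rank u)); split.
- set A := [set v : V | _]%SET; rewrite -(cardC A) leq_add2l.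
  have AJ v : v \in [predC A] -> (enum_rank v < #|J|)%N.
    by rewrite !inE -ltnNge.
  rewrite -[leqRHS]card_ord.
  (* [v0] serves to build the default value of [insubd]; if there is no such point, the complement
     of [A] is empty. *)
  case: (pickP [predC A]) => [v0 Av0|A0]; last by rewrite (eq_card0 A0).
  pose k (v : V) : 'I_#|J| :=
    insubd (Ordinal (AJ _ Av0)) (val (enum_rank v)).
  rewrite -(card_in_imset (f := k)) ?max_card //.
  move=> u v Au Av /(congr1 val); rewrite !val_insubd !AJ // => E.
  exact/enum_rank_inj/val_inj.
- move=> u w; rewrite (sumV (fun k => Z (enum_rank u) k * invmx Z k (enum_rank w))).
  have /matrixP/(_ (enum_rank u) (enum_rank w)) := mulmxV Zu.
  by rewrite !mxE rank_eq.
- move=> u w; rewrite (sumV (fun k => invmx Z (enum_rank u) k * Z k (enum_rank w))).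
  have /matrixP/(_ (enum_rank u) (enum_rank w)) := mulVmx Zu.
  by rewrite !mxE rank_eq.
- move=> j u; rewrite inE => Ju; rewrite !mxE big1 // => i _; rewrite mxE.
  rewrite (ltn_eqF (leq_trans (ltn_ord i) Ju)) ?mulr0n ?mulr0 //.
- move=> j v; have /matrixP/(_ (enum_rank j) (enum_rank v)) := defM.
  rewrite mxE !enum_rankK => ->; rewrite mxE.
  by rewrite (sumV (fun i => (L *m D) (enum_rank j) i * Z i (enum_rank v))).
Qed.

(** * Continuity of monomial maps *)

Section MonomialContinuity.
Variable K : numFieldType.
Local Notation C := (K^o).
Local Open Scope classical_set_scope.
Implicit Types (I J : finType).

Lemma cvg_exprz (T : Type) (F : set_system T) (FF : Filter F) (f : T -> C) (a : C)
  (k : int) : a != 0 -> f x @[x --> F] --> a -> f x ^ k @[x --> F] --> a ^ k.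
Proof.
move=> a0 fa; have fX n : f x ^+ n @[x --> F] --> a ^+ n.
  elim: n => [|n IHn]; first exact: cvg_cst.
  under eq_fun do rewrite exprS.
  by rewrite exprS; exact: cvgM.
case: k => k; rewrite /exprz //; apply: cvgV; last exact: fX.
by rewrite expf_neq0.
Qed.

Lemma cvg_prod (T I : Type) (F : set_system T) (FF : Filter F) (s : seq I)
  (f : I -> T -> C) (a : I -> C) : (forall i, f i x @[x --> F] --> a i) ->
  \prod_(i <- s) f i x @[x --> F] --> \prod_(i <- s) a i.
Proof.
move=> fa; elim: s => [|i s IHs].
  by under eq_fun do rewrite big_nil; rewrite big_nil; exact: cvg_cst.
by under eq_fun do rewrite big_cons; rewrite big_cons; exact: cvgM.
Qed.

Lemma cvg_ptws I (F : set_system {ptws I -> C}) (FF : Filter F) (t : {ptws I -> C}) :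
  (forall i, x i @[x --> F] --> t i) -> F --> t.
Proof.
move=> Ft; apply/cvg_sup => i A [B [[W oW <-] Wt] WA].
by apply: filterS WA _; apply: (Ft i); exact: open_nbhs_nbhs.
Qed.

Lemma monomial_coord_cvg I J (A : J -> I -> int) (t : {ptws I -> C}) j :
  (forall i, t i != 0) -> monomial A (x : {ptws I -> C}) j @[x --> t] --> monomial A t j.
Proof.
move=> t0; rewrite /monomial.
have FF : Filter (nbhs t) by exact: nbhs_filter.
have H i : (x : {ptws I -> C}) i @[x --> t] --> t i.
  exact: (@proj_continuous I (fun=> C) i t).
have H' i := cvg_exprz FF (k := A j i) (t0 i) (H i).
exact: (cvg_prod FF (s := index_enum I) H').
Qed.

Lemma monomial_cvg I J (A : J -> I -> int) (t : {ptws I -> C}) :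
  (forall i, t i != 0) ->
  (monomial A : {ptws I -> C} -> {ptws J -> C}) x @[x --> t] --> (monomial A t : {ptws J -> C}).
Proof.
move=> t0.
pose m : {ptws I -> C} -> {ptws J -> C} := monomial A.
have FF : Filter (fmap m (nbhs t)).
  exact: (fmap_filter m (nbhs_filter t)).
apply: (cvg_ptws FF) => j.
exact: (monomial_coord_cvg (A := A) (j := j) t0).
Qed.

Lemma norm_coord_cvg I (t : {ptws I -> C}) i :
  (`|(x : {ptws I -> C}) i| : C) @[x --> t] --> (`|t i| : C).
Proof.
have H : (x : {ptws I -> C}) i @[x --> t] --> t i.
  exact: (@proj_continuous I (fun=> C) i t).
exact: (cvg_norm H).
Qed.

(** The neighbourhoods of [t] traced on [G] form a proper filter, along which [h] tends to both [a]
    and [b]. *)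
Lemma closure_cvg_eq (T : topologicalType) (G : set T) (t : T) (h : T -> C) (a b : C) :
  closure G t -> (forall x, G x -> h x = b) -> h x @[x --> t] --> a -> a = b.
Proof.
move=> clt hb ha; have FF : ProperFilter (within G (nbhs t)).
  exact: within_nbhs_proper.
have ha' : h x @[x --> within G (nbhs t)] --> a.
  by apply: cvg_trans ha; apply: cvg_app; exact: cvg_within.
have hb' : h x @[x --> within G (nbhs t)] --> b.
  by apply: cvg_near_cst; apply: filterS (withinT G (nbhs_filter t)) => x /hb.
exact: (cvg_unique (@norm_hausdorff _ _) ha' hb').
Qed.

End MonomialContinuity.

(** * Tori acting freely on moment-angle complexes *)

Section FreeTorus.
Variable R : realType.
Local Notation C := (R[i])^o.
Local Open Scope classical_set_scope.
Implicit Types (I J V : finType).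

Lemma torus_neq0 I (t : {ptws I -> C}) : @torus R I t -> forall i, t i != 0.
Proof. by move=> tT i; rewrite -normr_gt0 (tT i). Qed.

Lemma torus_monomial I J (A : J -> I -> int) (t : {ptws I -> C}) :
  @torus R I t -> @torus R J (monomial A t).
Proof.
(* The norm of (R[i])^o is only convertible to that of R[i], to which the norm
   lemmas apply; hence the uses of [change]. *)
move=> tT j; change (`|\prod_i (t i : R[i]) ^ A j i| = 1).
rewrite normr_prod big1 // => i _.
have t1 : `|t i : R[i]| = 1 := tT i.
by case: (A j i) => k; rewrite /exprz ?normfV normrX t1 expr1n ?invr1.
Qed.

Lemma monomial_continuous I J (A : J -> I -> int) :
  {within @torus R I,
    continuous (monomial A : {ptws I -> C} -> {ptws J -> C})}.
Proof.
apply: continuous_in_subspaceT => t /set_mem /torus_neq0 t0.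
exact: (@monomial_cvg R[i] I J A t t0).
Qed.

Lemma closed_torus_monomial I J (A : J -> I -> int) (P : pred J) :
  closed [set t : {ptws I -> C} |
    @torus R I t /\ forall j, P j -> monomial A t j = 1].
Proof.
set G := [set t | _] => t clt.
(* Norm one comes first: it keeps the coordinates of [t] away from 0, where negative exponents would
   break continuity. *)
have tT : @torus R I t.
  move=> i; rewrite /S1 /=.
  apply: (@closure_cvg_eq R[i] _ G t (fun x => `|x i|) _ _ clt) => [x [xT _]|].
    exact: xT.
  exact: (@norm_coord_cvg R[i] I t i).
split=> // j Pj; apply: (@closure_cvg_eq R[i] _ G t (fun x => monomial A x j) _ _ clt).
  by move=> x [_ x1]; exact: x1.
exact: (@monomial_coord_cvg R[i] I J A t j (torus_neq0 tT)).
Qed.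

(** In the coordinates [monomial P t], the group [G] below is a coordinate torus of rank [#|A|]. It
    lies in the kernel of [M] because [M = N P] and [N] vanishes on the columns in [A]. *)
Lemma free_rank_ker V J (K : scomplex V) (M : J -> V -> int) :
  (forall (I : {set V}) (t : {ptws V -> C}), I \in faces K -> @torus R V t ->
     (forall v, v \notin I -> t v = 1) -> (forall j, monomial M t j = 1) ->
     forall v, t v = 1) ->
  exists2 r, (#|V| <= r + #|J|)%N & free_rank R K r.
Proof.
move=> Mfree; have [A [P [Q [N [cA PQ QP NA defM]]]]] := smith_factor M.
exists #|A| => //.
pose G : set {ptws V -> C} := [set t : {ptws V -> C} | @torus R V t /\
  forall u, u \notin A -> monomial P t u = 1].
exists G; split.
- split.
  + by move=> t [].
  + split=> [i|u _]; last exact: monomial_one.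
    by change (`|1 : R[i]| = 1); rewrite normr1.
  + move=> s t [sT s1] [tT t1]; split=> [i|u Au].
      change (`|(s i : R[i]) * t i| = 1); rewrite normrM.
      by rewrite [X in X * _](sT i) [X in _ * X](tT i) mulr1.
    by rewrite monomial_mul s1 // t1 // mulr1.
  + move=> t [tT t1]; split=> [i|u Au].
      change (`|(t i : R[i])^-1| = 1); rewrite normfV.
      by rewrite [X in X^-1](tT i) invr1.
    by rewrite monomial_inv t1 // invr1.
  + exact: (@closed_torus_monomial V V P (fun u => u \notin A)).
- pose f : {ptws _ -> C} -> {ptws _ -> C} :=
    monomial (fun v (i : 'I_#|A|) => Q v (enum_val i)).
  pose g : {ptws _ -> C} -> {ptws _ -> C} :=
    monomial (fun (i : 'I_#|A|) v => P (enum_val i) v).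
  exists f, g; split.
  + move=> t tT; have t0 := torus_neq0 tT; split.
      split; first exact: torus_monomial.
      move=> u Au; rewrite monomial_comp // /monomial big1 // => i _.
      rewrite PQ; case: eqP => [E|_]; rewrite ?expr0z //.
      by move: Au; rewrite E enum_valP.
    apply/funext => i; rewrite /g /f monomial_comp //.
    rewrite -[RHS](monomial_delta id t); apply: eq_monomial => k.
    by rewrite PQ (inj_eq enum_val_inj).
  + move=> t [tT t1]; have t0 := torus_neq0 tT; split; first exact: torus_monomial.
    apply/funext => v.
    (* On [G] the factors indexed outside [A] are 1, so the product over [A] is the full product. *)
    transitivity (monomial Q (monomial P t) v).
      rewrite [RHS]/monomial (bigID (mem A)) /= [X in _ * X]big1 ?mulr1.
        by rewrite big_enum_val.
      by move=> u Au; rewrite t1 ?exp1rz.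
    rewrite monomial_comp // -[RHS](monomial_delta id t); apply: eq_monomial => w.
    by rewrite QP.
  + by move=> s t _ _; apply/funext => v; exact: monomial_mul.
  + exact: monomial_continuous.
  + apply: continuous_subspaceW; last exact: monomial_continuous.
    by move=> t [].
- move=> t x [tT t1] [I IK [_ xS]] tx.
  have t0 := torus_neq0 tT.
  apply/funext; apply: (Mfree I) => // [v vI|j].
    (* Off [I] the coordinates of [x] have norm one, so a [t] fixing [x] is 1 there. *)
    have xv0 : x v != 0 by rewrite -normr_gt0 (xS v vI).
    apply: (mulIf xv0); rewrite mul1r.
    by have := congr1 (@^~ v) tx.
  transitivity (monomial N (monomial P t) j).
    by rewrite monomial_comp //; apply: eq_monomial => v.
  rewrite {1}/monomial big1 // => u _.
  have [uA|uA] := boolP (u \in A); first by rewrite NA // expr0z.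
  by rewrite t1 // exp1rz.
Qed.

End FreeTorus.

(** * Combinatorial core: vanishing of weights on two layers *)

(* X u b c is the weight of the point (b, c, u); the last three hypotheses are
   what affine independence of its support is used for. *)
Section TwoLayers.
Variables (T : finType) (U : zmodType) (X : T -> bool -> bool -> U).
Local Notation y u := (X u false false + X u false true).
Hypothesis Xbalanced : forall u, y u = X u true false + X u true true.
Hypothesis sum_y : \sum_u (y u) = 0.
Hypothesis sum_X1 : \sum_u (X u false true + X u true true) = 0.
Hypothesis pair_pair : forall u b u' b', (u, b) != (u', b') ->
  X u b false != 0 -> X u b true != 0 ->
  X u' b' false != 0 -> X u' b' true != 0 -> False.
Hypothesis quad : forall u p q u' p' q', u != u' ->
  X u false p != 0 -> X u true q != 0 ->
  X u' false p' != 0 -> X u' true q' != 0 -> p (+) q != p' (+) q'.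
Hypothesis quad_pair : forall u p q u' p' q' u0 b, u != u' ->
  X u false p != 0 -> X u true q != 0 ->
  X u' false p' != 0 -> X u' true q' != 0 ->
  X u0 b false != 0 -> X u0 b true != 0 -> False.

Lemma two_layersE u b : X u b false + X u b true = y u.
Proof. by case: b; rewrite // -Xbalanced. Qed.

Lemma two_layers_pick u : y u != 0 ->
  exists p q, X u false p != 0 /\ X u true q != 0.
Proof.
move=> yu.
have [p Hp] : exists p, X u false p != 0.
  have [E|] := eqVneq (X u false false) 0; last by exists false.
  by exists true; move: yu; rewrite E add0r.
have [q Hq] : exists q, X u true q != 0.
  have [E|] := eqVneq (X u true false) 0; last by exists false.
  by exists true; move: yu; rewrite Xbalanced E add0r.
by exists p, q.
Qed.

(** If [y u] is nonzero, exactly one other fibre [u'] has nonzero weight, namely [- y u]; then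
    [sum_X1] equates two multiples of [y u] by consecutive integers. *)
Lemma two_layers_y u : y u = 0.
Proof.
apply/eqP/negPn/negP => yu.
have [u' u'u yu'] : exists2 u', u' != u & y u' != 0.
  case: (pickP (fun v => (v != u) && (y v != 0))) => [v /andP[]|Y].
    by exists v.
  move: sum_y; rewrite (bigD1 u) //= big1 ?addr0 => [/eqP|v vu].
    by rewrite (negPf yu).
  by apply/eqP; have := Y v; rewrite vu => /negbT/negPn.
have [p [q [Xp Xq]]] := two_layers_pick yu.
have [p' [q' [Xp' Xq']]] := two_layers_pick yu'.
(* A third fibre would give three pairwise distinct bits. *)
have y0 v : v != u -> v != u' -> y v = 0.
  move=> vu vu'; apply/eqP/negPn/negP => /two_layers_pick [r [s [Xr Xs]]].
  have := quad u'u Xp' Xq' Xp Xq; have := quad vu Xr Xs Xp Xq.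
  have := quad vu' Xr Xs Xp' Xq'.
  by case: (_ (+) _); case: (_ (+) _); case: (_ (+) _).
have single v b : X v b false = 0 \/ X v b true = 0.
  have [|nz0] := eqVneq (X v b false) 0; first by left.
  have [|nz1] := eqVneq (X v b true) 0; first by right.
  by case: (quad_pair u'u Xp' Xq' Xp Xq nz0 nz1).
have X0 v b c : y v = 0 -> X v b c = 0.
  move=> yv; have := two_layersE v b; rewrite yv.
  by case: (single v b) => E; rewrite E ?addr0 ?add0r => E'; case: c.
(* At most one entry over [(v, b)] is nonzero, and the two add up to [y v]. *)
have Xtrue v b c : X v b c != 0 -> X v b true = y v *+ c.
  rewrite -(two_layersE v b); case: c; case: (single v b) => ->;
  by rewrite ?eqxx ?add0r ?addr0.
have sum2 (f : T -> U) : (forall v, v != u -> v != u' -> f v = 0) ->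
    \sum_v f v = f u + f u'.
  move=> f0; rewrite (bigD1 u) //= (bigD1 u') //= big1 ?addr0 // => v.
  by case/andP => vu vu'; exact: f0.
have yuu' : y u' = - y u.
  by apply/eqP; rewrite -addr_eq0 addrC -(sum2 (fun v => y v)) ?sum_y.
have := sum_X1; rewrite sum2; last first.
  move=> v vu vu'; have yv := y0 _ vu vu'.
  by rewrite (X0 v false true yv) (X0 v true true yv) addr0.
rewrite (Xtrue _ _ _ Xp) (Xtrue _ _ _ Xq) (Xtrue _ _ _ Xp') (Xtrue _ _ _ Xq').
rewrite -!mulrnDr yuu' mulNrn => /eqP; rewrite subr_eq0 => E.
have step m : y u *+ m.+1 != y u *+ m by rewrite mulrS -subr_eq0 addrK.
have := quad u'u Xp' Xq' Xp Xq; clear - E step.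
case: p E; case: q; case: p'; case: q' => E // _;
  (* The multiplicities p + q and p' + q', both at most 2, differ by 1. *)
  first
    [exact: (negP (step 0%N) E) | exact: (negP (step 1%N) E)
    | rewrite eq_sym in E; exact: (negP (step 0%N) E)
    | rewrite eq_sym in E; exact: (negP (step 1%N) E)].
Qed.

(** Once every [y u] is 0, support points come in pairs over some [(u, b)]. By [pair_pair] there is
    at most one pair, and [sum_X1] reduces to its entry with [c] true. *)
Lemma two_layers_eq0 u b c : X u b c = 0.
Proof.
have flip v a d : X v a d != 0 -> X v a (~~ d) != 0.
  apply: contraNN => /eqP E; have := two_layersE v a; rewrite two_layers_y.
  by case: d E => /= ->; rewrite ?addr0 ?add0r => ->.
apply/eqP/negPn/negP => nz.
have nzb d : X u b d != 0.
  by case: c nz => nz; case: d => //; exact: (flip _ _ _ nz).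
have X0 v a : (u, b) != (v, a) -> X v a true = 0.
  move=> ne; apply/eqP/negPn/negP => nz'.
  exact: (pair_pair ne (nzb _) (nzb _) (flip _ _ _ nz') nz').
move: sum_X1; rewrite (bigD1 u) //= big1 ?addr0; last first.
  by move=> v vu; rewrite !X0 ?addr0 // xpair_eqE eq_sym (negPf vu).
have := nzb true; clear nz nzb; case: b X0 => X0 nzu.
  by rewrite (X0 u false) ?add0r ?xpair_eqE ?eqxx // => E; rewrite E eqxx in nzu.
by rewrite (X0 u true) ?addr0 ?xpair_eqE ?eqxx // => E; rewrite E eqxx in nzu.
Qed.

End TwoLayers.

(** * Characters of F_2^n and linear independence *)

Section Pairing.
Variable n : nat.
Implicit Types (v w : 'rV['F_2]_n).

Definition pairing w v : 'F_2 := (w *m v^T) 0 0.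

Lemma pairingDl w w' v : pairing (w + w') v = pairing w v + pairing w' v.
Proof. by rewrite /pairing mulmxDl mxE. Qed.

Lemma pairingDr w v v' : pairing w (v + v') = pairing w v + pairing w v'.
Proof. by rewrite /pairing linearD mulmxDr mxE. Qed.

Lemma pairing0r w : pairing w 0 = 0.
Proof. by rewrite /pairing trmx0 mulmx0 mxE. Qed.

Lemma pairing0l v : pairing 0 v = 0.
Proof. by rewrite /pairing mul0mx mxE. Qed.

Lemma pairing_sumr w (s : seq 'rV['F_2]_n) :
  pairing w (\sum_(v <- s) v) = \sum_(v <- s) pairing w v.
Proof. by rewrite (big_morph _ (pairingDr w) (pairing0r w)). Qed.

Lemma pairing_delta j v : pairing (delta_mx 0 j) v = v 0 j.
Proof. by rewrite /pairing -rowE !mxE. Qed.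

Definition sgn2 (z : 'F_2) : int := (-1) ^+ z.

Lemma F2_ind (P : 'F_2 -> Prop) : P 0 -> P 1 -> forall z, P z.
Proof.
move=> P0 P1 [[|[|//]] zlt].
  by have -> : Ordinal zlt = 0 by exact: val_inj.
by have -> : Ordinal zlt = 1 by exact: val_inj.
Qed.

Lemma sgn2D (y z : 'F_2) : sgn2 (y + z) = sgn2 y * sgn2 z.
Proof. by elim/F2_ind: y; elim/F2_ind: z. Qed.

(** This expresses 0/1 matrix entries through characters, at the cost of a factor 2. *)
Lemma sgn2_val (z : 'F_2) : (z : nat)%:Z *+ 2 = 1 - sgn2 z.
Proof. by elim/F2_ind: z. Qed.

Lemma addF2_eq0 (u v : 'rV['F_2]_n) : (u + v == 0) = (v == u).
Proof.
rewrite addr_eq0 eq_sym; congr (_ == _); apply/rowP => i; rewrite !mxE.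
by elim/F2_ind: (v 0 i); apply/eqP.
Qed.

(** Orthogonality of characters: if [v] has a coordinate [j] equal to 1, translating [a] by the unit
    vector [j] flips every sign. *)
Lemma sum_sgn2 v : \sum_a sgn2 (pairing a v) = (v == 0)%:R * (2 ^ n)%:Z.
Proof.
have [->|v0] := eqVneq v 0.
  under eq_bigr do rewrite pairing0r.
  by rewrite sumr_const card_mx card_Fp // mul1n mul1r -natz.
rewrite mul0r; have [j vj] : exists j, v 0 j = 1.
  case: (pickP (fun j => v 0 j != 0)) => [j b|v_eq0].
    by exists j; move: b; elim/F2_ind: (v 0 j).
  case/eqP: v0; apply/rowP => j; rewrite mxE.
  by apply/eqP/negPn; rewrite v_eq0.
set s := LHS; suff: s = - s by move=> /eqP; rewrite -addr_eq0 -mulr2n mulrn_eq0 => /eqP.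
rewrite {1}/s (reindex_inj (addrI (delta_mx 0 j))) /= -sumrN.
by apply: eq_bigr => a _; rewrite pairingDl pairing_delta vj sgn2D mulN1r.
Qed.

(** Linear independence, in the form of prescribing the values of a linear form on [I]. *)
Definition dual_set (I : {pred 'rV['F_2]_n}) :=
  forall g : 'rV['F_2]_n -> 'F_2, exists w, {in I, forall v, pairing w v = g v}.

(* Together with the origin, an independent set is affinely independent. *)
Lemma dual_set_even (I : {pred 'rV['F_2]_n}) (s : seq 'rV['F_2]_n) :
  dual_set I -> all [predU1 0 & I] s -> ~~ odd (size s) ->
  \sum_(v <- s) v = 0 -> forall g : 'rV['F_2]_n -> 'F_2, \sum_(v <- s) g v = 0.
Proof.
(* Subtracting [g 0] makes the function vanish at the origin, hence linear on [0] and [I]; an even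
   number of copies of [g 0] cancels. *)
move=> dI sI ev s0 g; have [w wE] := dI (fun v => g v - g 0).
have : pairing w (\sum_(v <- s) v) = 0 by rewrite s0 pairing0r.
rewrite pairing_sumr big_seq (eq_bigr (fun v => g v - g 0)); last first.
  move=> v /(allP sI) /predU1P[->|vI]; first by rewrite pairing0r subrr.
  exact: wE.
have F2_double (z : 'F_2) : z *+ 2 = 0 by elim/F2_ind: z; apply/eqP.
rewrite -big_seq big_split /= big_const_seq count_predT iter_addr_0.
by rewrite -[size s]odd_double_half (negPf ev) -muln2 mulnC mulrnA F2_double
  mul0rn addr0.
Qed.

End Pairing.

(** * Injectivity of the matrix on independent supports *)

Section Weights.
Variable k : nat.
Local Notation n := (1 + (1 + k))%N.
Implicit Types (u a : 'rV['F_2]_k) (b c : bool).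

Definition vec b c u : 'rV['F_2]_n := row_mx (b%:R)%:M (row_mx (c%:R)%:M u).

Lemma pairing_vec b c a b' c' u :
  pairing (vec b c a) (vec b' c' u) =
  (b && b')%:R + ((c && c')%:R + pairing a u).
Proof.
rewrite /pairing /vec !tr_row_mx !mul_row_col !mxE !big_ord1 !mxE /= !mulr1n.
by case: b; case: b'; case: c; case: c'; rewrite !(mulr0, mul0r, mulr1).
Qed.

Lemma vec_inj b c u b' c' u' :
  (vec b c u == vec b' c' u') = [&& b == b', c == c' & u == u'].
Proof.
apply/eqP/and3P => [|[/eqP-> /eqP-> /eqP->]//].
move=> /eq_row_mx [Eb /eq_row_mx [Ec ->]]; rewrite eqxx.
move: Eb Ec => /matrixP/(_ 0 0) + /matrixP/(_ 0 0).
by rewrite !mxE; case: b; case: b'; case: c; case: c'.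
Qed.

Lemma vec0 : vec false false 0 = 0.
Proof. by rewrite /vec !raddf0 !row_mx0. Qed.

Lemma vecD b c u b' c' u' :
  vec b c u + vec b' c' u' = vec (b (+) b') (c (+) c') (u + u').
Proof.
rewrite /vec !add_row_mx -!raddfD /=.
by congr (row_mx _%:M (row_mx _%:M _)); case: b b' c c' => [] [] [] [];
  apply/eqP.
Qed.

Lemma vec_bij :
  bijective (fun p : 'rV['F_2]_k * (bool * bool) => vec p.2.1 p.2.2 p.1).
Proof.
pose h (p : 'rV['F_2]_k * (bool * bool)) := vec p.2.1 p.2.2 p.1.
have hI : injective h.
  move=> [u [b c]] [u' [b' c']] /eqP; rewrite /h vec_inj /=.
  by case/and3P => /eqP-> /eqP-> /eqP->.
apply: (inj_card_bij hI); rewrite !card_prod card_bool !card_mx card_Fp //.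
by rewrite !mul1n -[(2 * 2)%N]/(2 ^ 2)%N -expnD -[(1 + (1 + k))%N]/(2 + k)%N addnC.
Qed.

Lemma vec_surj v : exists b c u, v = vec b c u.
Proof.
by have [g _ gK] := vec_bij; exists (g v).2.1, (g v).2.2, (g v).1; rewrite gK.
Qed.

Lemma sum_vec (U : zmodType) (F : 'rV['F_2]_n -> U) :
  \sum_v F v = \sum_u (F (vec false false u) + F (vec false true u)
                       + (F (vec true false u) + F (vec true true u))).
Proof.
pose h (p : 'rV['F_2]_k * (bool * bool)) := vec p.2.1 p.2.2 p.1.
rewrite (reindex h) /=; last exact/onW_bij/vec_bij.
rewrite -(pair_bigA _ (fun u p => F (h (u, p)))) /=; apply: eq_bigr => u _.
rewrite -(pair_bigA _ (fun b c => F (vec b c u))) /= !big_bool /=.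
by rewrite addrC; congr (_ + _); rewrite addrC.
Qed.


Section Relations.
Variables (U : zmodType) (I : {pred 'rV['F_2]_n}).
Hypothesis dI : dual_set I.

Definition row_relations (x : 'rV['F_2]_n -> U) :=
  [/\ forall v, x v != 0 -> v \in I,
      forall a, \sum_v x v *+ pairing (vec true false a) v = 0 &
      \sum_v x v *+ pairing (vec false true 0) v = 0].

Lemma dual_set0 : 0 \notin I.
Proof.
apply/negP => I0; have [w /(_ 0 I0)] := dI (fun=> 1).
by rewrite pairing0r => /eqP; rewrite eq_sym oner_eq0.
Qed.

Lemma row_relations0 x : row_relations x -> x 0 = 0.
Proof.
case=> xI _ _; apply/eqP/negPn/negP => /xI; exact/negP/dual_set0.
Qed.

(** For 2-torsion weights, [phi] is additive in [w], so it vanishes on the span of the rows, which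
    is everything; a dual vector then isolates [x v0]. *)
Lemma row_relations_torsion2 x :
  row_relations x -> (forall v, x v *+ 2 = 0) -> forall v, x v = 0.
Proof.
move=> [xI x1 x2] xx v0.
pose phi w := \sum_v x v *+ pairing w v.
have phiD w w' : phi (w + w') = phi w + phi w'.
  rewrite /phi -big_split; apply: eq_bigr => v _ /=; rewrite pairingDl.
  elim/F2_ind: (pairing w v); elim/F2_ind: (pairing w' v);
    by rewrite ?(addr0, add0r) //= -?mulr2n ?xx.
have phi0 w : phi w = 0.
  have phi00 a : phi (vec false false a) = 0.
    have := vecD true false a true false 0; rewrite addr0 => <-.
    by rewrite phiD /phi !x1 addr0.
  have [b [c [a ->]]] := vec_surj w.
  have phi0c : phi (vec b false a) = 0 by case: b; [exact: x1 | exact: phi00].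
  case: c => //; have := vecD b false a false true 0.
  by rewrite addr0 addbF => <-; rewrite phiD phi0c add0r; exact: x2.
have [->//|/xI v0I] := eqVneq (x v0) 0.
have [w wE] := dI (fun v => (v == v0)%:R).
rewrite -(phi0 w) /phi (bigD1 v0) //= wE // eqxx mulr1n big1 ?addr0 // => v vv0.
have [->|/xI vI] := eqVneq (x v) 0; first by rewrite mul0rn.
by rewrite wE // (negPf vv0) mulr0n.
Qed.

(** By [sgn2_val], twice an entry is 1 minus a sign, which leaves the difference of two character
    sums. *)
Lemma sum_sgn2_row b c u u' :
  \sum_a (pairing (vec true false a) (vec b c u'))%:Z * (sgn2 (pairing a u) *+ 2)
  = (2 ^ k)%:Z * ((u == 0)%:R - (-1) ^+ b * (u' == u)%:R).
Proof.
transitivity (\sum_a (sgn2 (pairing a u) - (-1) ^+ b * sgn2 (pairing a (u + u')))).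
  apply: eq_bigr => a _; rewrite mulrnAr -mulrnAl sgn2_val pairing_vec add0r.
  rewrite !sgn2D pairingDr sgn2D mulrBl mul1r; congr (_ - _).
  by rewrite -mulrA; congr (_ * _); [case: b | exact: mulrC].
by rewrite sumrB -mulr_sumr !sum_sgn2 addF2_eq0 mulrBr mulrC mulrA [_ * (2 ^ k)%:Z]mulrC.
Qed.

(** Add up the relations of the rows [a] with coefficients [sgn2 (pairing a u) *+ 2]; only the fibre
    over [u] and, for [u = 0], the total weight survive. *)
Lemma row_relations_fourier x u :
  row_relations x -> let z v := x v *+ 2 ^ k in
  \sum_v z v *+ (u == 0) = z (vec false false u) + z (vec false true u)
    - (z (vec true false u) + z (vec true true u)).
Proof.
move=> [_ x1 _] z.
pose r v := \sum_a (x v *+ pairing (vec true false a) v) *~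
  (sgn2 (pairing a u) *+ 2).
have r0 : \sum_v r v = 0.
  rewrite exchange_big big1 // => a _ /=.
  by rewrite -mulrz_suml x1 mul0rz.
have rE b c u' : z (vec b c u') *+ (u == 0) - r (vec b c u') =
    z (vec b c u') *~ ((-1) ^+ b * (u' == u)%:R).
  have -> : r (vec b c u') =
      z (vec b c u') *~ ((u == 0)%:R - (-1) ^+ b * (u' == u)%:R).
    rewrite /z pmulrn -mulrzA -(sum_sgn2_row b c) mulrz_sumr.
    by apply: eq_bigr => a _; rewrite pmulrn mulrzA.
  by rewrite mulrzBr pmulrn natz opprB addrC subrK.
transitivity (\sum_v (z v *+ (u == 0) - r v)); first by rewrite sumrB r0 subr0.
rewrite sum_vec (bigD1 u) //= big1 ?addr0; last first.
  by move=> u' /negPf nu; rewrite !rE nu !mulr0 !mulr0z !addr0.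
by rewrite !rE eqxx !mulr1 !mulr1z !mulrN1z opprD.
Qed.

Lemma row_relations_pow2 x : row_relations x -> forall v, x v *+ 2 ^ k.+1 = 0.
Proof.
move=> xR; have x0 := row_relations0 xR; have [xI _ x2] := xR.
pose z v := x v *+ 2 ^ k.
(* The zero vector does not occur in the relations, so its weight z0 can be
   chosen to balance the fibre over u = 0. *)
pose z0 := z (vec true false 0) + z (vec true true 0) - z (vec false true 0).
pose Z v := if v == 0 then z0 else z v.
(* The factor 2 yields [sum_y]: by balance, twice the weight of the layer [b = false] is the total
   weight, which is zero. *)
pose X u b c := Z (vec b c u) *+ 2.
have z00 : z 0 = 0 by rewrite /z x0 mul0rn.
have four u : \sum_v z v *+ (u == 0) =
    z (vec false false u) + z (vec false true u)
    - (z (vec true false u) + z (vec true true u)) by exact: row_relations_fourier.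
have vecn0 b c u : (vec b c u == 0) = [&& ~~ b, ~~ c & u == 0].
  by rewrite -vec0 vec_inj; case: b; case: c.
have balZ u : Z (vec false false u) + Z (vec false true u) =
              Z (vec true false u) + Z (vec true true u).
  rewrite /Z !vecn0 /=; have [->|u0] := eqVneq u 0; first by rewrite /z0 subrK.
  apply/eqP; rewrite -subr_eq0 -four big1 // => v _.
  by rewrite (negPf u0) mulr0n.
(* The Fourier relation at [u = 0] says that the [z v] add up to [- z0]. *)
have sumZ : \sum_v Z v = 0.
  rewrite (bigD1 0) //= {1}/Z eqxx (eq_bigr z); last first.
    by move=> v /negPf v0; rewrite /Z v0.
  have := four 0; rewrite eqxx (bigD1 0) //= vec0 z00 !add0r => ->.
  by apply/eqP; rewrite addr_eq0 opprB.
have supp u b c : X u b c != 0 -> vec b c u \in [predU1 0 & I].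
  move=> nz; apply/predU1P; have [|v0] := eqVneq (vec b c u) 0; [by left | right].
  by apply: xI; apply: contraNneq nz => E; rewrite /X /Z (negPf v0) /z E !mul0rn.
suff X0 : forall u b c, X u b c = 0.
  move=> v; have [->|v0] := eqVneq v 0; first by rewrite x0 mul0rn.
  have [b1 [c1 [u1 vE]]] := vec_surj v.
  by have := X0 u1 b1 c1; rewrite /X /Z -vE (negPf v0) /z -mulrnA -expnSr.
(* Every vector occurs an even number of times in such an [s]. *)
have even (s : seq 'rV['F_2]_n) : all [predU1 0 & I] s -> ~~ odd (size s) ->
  \sum_(v <- s) v = 0 -> forall b c u, \sum_(v <- s) (v == vec b c u)%:R = 0 :> 'F_2.
  by move=> sI es s0 b c u'; exact: (dual_set_even dI sI es s0 (fun v => (v == _)%:R)).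
have uu (u : 'rV['F_2]_k) : u + u = 0 by apply/eqP; rewrite addF2_eq0.
have uuK (u w : 'rV['F_2]_k) : u + (u + w) = w by rewrite addrA uu add0r.
have quadX u p q u' p' q' : u != u' ->
    X u false p != 0 -> X u true q != 0 ->
    X u' false p' != 0 -> X u' true q' != 0 -> p (+) q != p' (+) q'.
  move=> nuu' /supp v1 /supp v2 /supp v3 /supp v4; apply/eqP => E.
  (* With equal parities these four points add up to 0, yet the first occurs only once. *)
  suff : \sum_(v <- [:: vec false p u; vec true q u; vec false p' u'; vec true q' u'])
      (v == vec false p u)%:R = 0 :> 'F_2.
    by rewrite !big_cons big_nil !vec_inj !eqxx /= (eq_sym u') (negPf nuu') !andbF.
  apply: even => //; first by apply/and5P; split.
  rewrite !big_cons big_nil addr0 !vecD uuK uu -vec0; congr vec.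
  by rewrite addbA E addbb.
apply: two_layers_eq0.
- by move=> u; rewrite /X -!mulrnDl balZ.
- rewrite -[RHS]sumZ sum_vec; apply: eq_bigr => u _.
  by rewrite -balZ /X -mulrnDl mulr2n.
(* The modified weight at the origin has [c = false], so it does not enter this sum. *)
- transitivity ((\sum_v x v *+ pairing (vec false true 0) v) *+ 2 ^ k.+1);
    last by rewrite x2 mul0rn.
  rewrite -sumrMnl sum_vec.
  apply: eq_bigr => u _; rewrite !pairing_vec pairing0l /X /Z !vecn0 /= /z.
  by rewrite -!mulrnA -!expnSr !(add0r, addr0) ?mul0n ?mul1n.
- move=> u b u' b' ne /supp v1 /supp v2 /supp v3 /supp v4.
  suff : \sum_(v <- [:: vec b false u; vec b true u; vec b' false u'; vec b' true u'])
      (v == vec b false u)%:R = 0 :> 'F_2.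
    rewrite !big_cons big_nil !vec_inj !eqxx /= andbF !addr0.
    by move: ne; rewrite xpair_eqE (eq_sym u) (eq_sym b) andbC => /negPf->.
  apply: even => //; first by apply/and5P; split.
  rewrite !big_cons big_nil addr0 !vecD uuK uu -vec0; congr vec.
  by case: (b); case: (b').
- exact: quadX.
- move=> u p q u' p' q' u0 b nuu' X1 X2 X3 X4 X5 X6.
  have := quadX _ _ _ _ _ _ nuu' X1 X2 X3 X4.
  move: X1 X2 X3 X4 X5 X6 => /supp v1 /supp v2 /supp v3 /supp v4 /supp v5 /supp v6 ne.
  (* By [quadX] the first four points add up to (0, 1, 0), and so do the last two. *)
  pose s := [:: vec false p u; vec true q u; vec false p' u'; vec true q' u';
    vec b false u0; vec b true u0].
  have sI : all [predU1 0 & I] s by apply/and5P; split=> //; apply/and3P; split.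
  have s0 : \sum_(v <- s) v = 0.
    rewrite !big_cons big_nil addr0 !vecD !uuK uu -vec0; congr vec.
      by case: (b).
    by move: ne; case: (p); case: (q); case: (p'); case: (q').
  (* The pair over [u0] may repeat a point over [u] or [u']; the test point is taken over whichever
     of these differs from [u0]. *)
  have := even s sI isT s0; have [E|nuu0] := eqVneq u u0.
    move/(_ false p' u'); rewrite !big_cons big_nil !vec_inj -E !eqxx /=.
    by rewrite (negPf nuu') !andbF.
  move/(_ false p u); rewrite !big_cons big_nil !vec_inj !eqxx /=.
  by rewrite (eq_sym u') (eq_sym u0) (negPf nuu') (negPf nuu0) !andbF.
Qed.

(** Powers of 2 are removed one at a time: if [2 ^ N.+1] kills [x], then [x *+ 2 ^ N] is a 2-torsion
    solution. *)
Lemma row_relations_eq0 x : row_relations x -> forall v, x v = 0.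
Proof.
move=> xR; have := row_relations_pow2 xR.
elim: k.+1 x xR => [|N IHN] x xR xN; first by move=> v; rewrite -(xN v) mulr1n.
apply: IHN => //; apply: row_relations_torsion2 => [|v]; last first.
  by rewrite -mulrnA -expnSr xN.
have [xI x1 x2] := xR; split=> [v nz|a|].
- by apply: xI; apply: contraNneq nz => ->; rewrite mul0rn.
- under eq_bigr do rewrite mulrnAC.
  by rewrite sumrMnl x1 mul0rn.
- under eq_bigr do rewrite mulrnAC.
  by rewrite sumrMnl x2 mul0rn.
Qed.

End Relations.
End Weights.

(** * Multiplicative coefficients and the universal complex *)

(* The multiplicative group of F written additively, to serve as the zmodType
   of coefficients in row_relations. *)
Section UnitGroup.
Variable F : fieldType.

Record unit_group := UnitGroup { unit_val : F ; unit_valP : unit_val != 0 }.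
HB.instance Definition _ := [isSub for unit_val].
HB.instance Definition _ := [Choice of unit_group by <:].

Implicit Types x y z : unit_group.

Definition unit_mul x y := UnitGroup (mulf_neq0 (unit_valP x) (unit_valP y)).
Definition unit_one := UnitGroup (oner_neq0 F).
Lemma unit_inv_neq0 x : (unit_val x)^-1 != 0.
Proof. by rewrite invr_eq0 unit_valP. Qed.
Definition unit_inv x := UnitGroup (unit_inv_neq0 x).

Lemma unit_mulA : associative unit_mul.
Proof. by move=> x y z; apply/val_inj; rewrite /= mulrA. Qed.
Lemma unit_mulC : commutative unit_mul.
Proof. by move=> x y; apply/val_inj; rewrite /= mulrC. Qed.
Lemma unit_mul1 : left_id unit_one unit_mul.
Proof. by move=> x; apply/val_inj; rewrite /= mul1r. Qed.
Lemma unit_mulV : left_inverse unit_one unit_inv unit_mul.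
Proof. by move=> x; apply/val_inj; rewrite /= mulVf // unit_valP. Qed.

HB.instance Definition _ :=
  GRing.isZmodule.Build unit_group unit_mulA unit_mulC unit_mul1 unit_mulV.

Lemma unit_val_sum (I : finType) (f : I -> unit_group) :
  unit_val (\sum_i f i) = \prod_i unit_val (f i).
Proof. exact: (big_morph unit_val (id1 := 1) (op1 := *%R)). Qed.

Lemma unit_val_mulrn x n : unit_val (x *+ n) = unit_val x ^+ n.
Proof. by elim: n => // n IHn; rewrite mulrS exprS -IHn. Qed.

End UnitGroup.

Lemma basis_dual n (b : n.-tuple 'rV['F_2]_n) :
  basis_of {: 'rV['F_2]_n} b -> dual_set (mem b).
Proof.
move=> bB g; have bfree := basis_free bB.
(* The values at the unit vectors of the linear form sending each basis vector [b_i] to [g b_i]. *)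
exists (\row_j \sum_i coord b i (delta_mx 0 j) * g b`_i) => v vb.
have pairE w : pairing (\row_j \sum_i coord b i (delta_mx 0 j) * g b`_i) w =
    \sum_i coord b i w * g b`_i.
  rewrite /pairing mxE; under eq_bigr do rewrite !mxE mulr_suml.
  rewrite exchange_big; apply: eq_bigr => i _ /=.
  rewrite {2}[w]row_sum_delta linear_sum mulr_suml; apply: eq_bigr => j _.
  by rewrite linearZ /= mulrAC [_ * w 0 j]mulrC.
have /tnthP[i ->] := vb; rewrite pairE (bigD1 i) //= (tnth_nth 0).
rewrite coord_free // eqxx mul1r big1 ?addr0 // => j ji.
by rewrite coord_free // eq_sym (negPf ji) mul0r.
Qed.

Lemma prod_nzvec (R : comPzRingType) n (f : 'rV['F_2]_n -> R) :
  f 0 = 1 -> \prod_v f v = \prod_(v : nzvec n) f (val v).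
Proof.
move=> f0; rewrite (bigD1 0) //= f0 mul1r.
rewrite (reindex_omap (val : nzvec n -> 'rV['F_2]_n) insub) /=; last first.
  by move=> v v0; rewrite insubT.
by apply: eq_bigl => -[v v0] /=; rewrite insubT v0 eqxx.
Qed.

Section Universal.
Variable k : nat.
Local Notation n := (1 + (1 + k))%N.

Definition char_row (j : option 'rV['F_2]_k) : 'rV['F_2]_n :=
  if j is Some a then vec true false a else vec false true 0.

Definition char_mx (j : option 'rV['F_2]_k) (v : nzvec n) : int :=
  (pairing (char_row j) (val v))%:Z.

Lemma char_mx_free (F : fieldType) (I : {set nzvec n}) (t : nzvec n -> F) :
  I \in universal_faces n -> (forall v, t v != 0) ->
  (forall v, v \notin I -> t v = 1) -> (forall j, monomial char_mx t j = 1) ->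
  forall v, t v = 1.
Proof.
rewrite inE => /existsP[b /andP[bB /forall_inP Ib]] t0 tI Mt.
(* The origin is not a vertex; it gets the neutral weight, so that sums run over the whole space. *)
pose x (v : 'rV['F_2]_n) : unit_group F :=
  if insub v is Some v' then UnitGroup (t0 v') else 0.
have xE (v : nzvec n) : unit_val (x (val v)) = t v by rewrite /x valK.
have x0 : x 0 = 0 by rewrite /x insubF // eqxx.
have rel j : \sum_v x v *+ pairing (char_row j) v = 0.
  apply/val_inj; rewrite /= unit_val_sum prod_nzvec; last by rewrite x0 mul0rn.
  rewrite -[RHS](Mt j); apply: eq_bigr => v _.
  by rewrite unit_val_mulrn xE.
have xR : row_relations (mem b) x.
  split=> [v|a|]; [|exact: (rel (Some a))|exact: (rel None)].
  rewrite /x; case: insubP => [v' _ <-|]; last by rewrite eqxx.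
  move=> nz; apply: Ib; apply: contraNT nz => /tI t1.
  by apply/eqP/val_inj.
by move=> v; rewrite -xE (row_relations_eq0 (basis_dual bB) xR).
Qed.

End Universal.

(** * The real upper bound and the conclusion *)

Lemma card_nzvec n : #|{: nzvec n}| = (2 ^ n - 1)%N.
Proof.
by rewrite card_sig -[#|_|]/#|predC1 0| cardC1 card_mx card_Fp // mul1n subn1.
Qed.

Lemma real_buchstaber_universal_le (R : realType) n :
  (real_buchstaber R (universal_complex n) <= 2 ^ n - 1 - n)%N.
Proof.
have [[H [<- Hfree]] _] := real_buchstaber_max R (universal_complex n).
have dn : \dim {: 'rV['F_2]_n} = n by rewrite dimvf /dim /= mul1n.
pose b := tcast dn (vbasis {: 'rV['F_2]_n}).
have bB : basis_of {: 'rV['F_2]_n} b by rewrite val_tcast vbasisP.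
pose I : {set nzvec n} := [set v | val v \in b]%SET.
have If : I \in universal_faces n.
  rewrite inE; apply/existsP; exists b; rewrite bB.
  by apply/forall_inP => v; rewrite inE.
have b0 i : tnth b i != 0 by exact: basis_not0 bB (mem_tnth i b).
have cI : (n <= #|I|)%N.
  pose h (i : 'I_n) : nzvec n := Sub (tnth b i) (b0 i).
  rewrite -[leqLHS]card_ord -(card_imset (f := h)); last first.
    move=> i j /(congr1 val) /=; rewrite !(tnth_nth 0) => /eqP.
    by rewrite nth_uniq ?size_tuple ?(free_uniq (basis_free bB)) // => /eqP/val_inj.
  apply/subset_leq_card/fintype.subsetP => _ /finset.imsetP[i _ ->].
  by rewrite inE /= mem_tnth.
have cH : (#|H| <= 2 ^ (2 ^ n - 1 - n))%N.
  (* Erasing the coordinates in [I] is injective on [H], and at most [2 ^ n - 1 - n] coordinates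
     remain. *)
  pose f (h : {ffun nzvec n -> 'F_2}) := [ffun v => if v \in I then 0 else h v].
  rewrite -(card_in_imset (f := f)).
    apply: (@leq_trans #|pffun_on (0 : 'F_2) [predC I] predT|).
      apply/subset_leq_card/fintype.subsetP => _ /finset.imsetP[h _ ->].
      apply/pffun_onP; split => //.
      by apply/supportP => v; rewrite ffunE inE negbK => ->.
    rewrite card_pffun_on card_Fp // leq_exp2l // -card_nzvec.
    by rewrite -(cardC (mem I)) leq_subRL ?(leq_trans cI) ?leq_addr // leq_add2r.
  move=> h1 h2 H1 H2 /ffunP E.
  (* This point is fixed by every sign change supported on [I]. *)
  pose x v : R := if v \in I then 0 else 1.
  have E0 : (h1 * h2^-1)%g = 0.
    apply: (Hfree _ x); first by rewrite /= groupM ?groupV.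
      exists I => //; split=> v; rewrite /x /D1 /S0 /=.
        by case: ifP; rewrite ?lexx ?ler01 ?lerN10 ?(le_trans (lerN10 R) ler01).
      by move/negPf ->; right.
    apply/funext => v; rewrite /sign_act /x; case: ifP => [|vI]; first by rewrite mulr0.
    have := E v; rewrite !ffunE vI => ->.
    by rewrite mulgV expr0 mulr1.
  apply/eqP; rewrite eq_mulgV1; apply/eqP; exact: E0.
case: (rank_witness H) => p p_pr ->; apply: leq_trans (p_rank_le_logn p H) _.
(* Whichever prime [p] attains the rank [e], [2 ^ e <= p ^ e <= #|H|]. *)
rewrite -(leq_exp2l (m := 2)) //; apply: leq_trans cH.
apply: leq_trans (dvdn_leq (cardG_gt0 H) (pfactor_dvdnn p #|H|)).
by case: (logn p #|H|) => [|e]; rewrite ?expn0 // leq_exp2r ?prime_gt1.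
Qed.

Theorem theorem1p2 (R : realType) (n : nat) (hn : (2 <= n)%N) :
  Delta R (universal_complex n) <= (2 ^ (n - 2))%N%:Z + 1 - n%:Z
  /\ (3 * 2 ^ (n - 2) - 2 <= buchstaber R (universal_complex n))%N.
Proof.
have low : (3 * 2 ^ (n - 2) - 2 <= buchstaber R (universal_complex n))%N.
  case: n hn => [|[|k]] // _; rewrite !subSS subn0.
  have [I t IK tT tI tM v|r rle fr] :=
      @free_rank_ker R _ _ (universal_complex k.+2) (@char_mx k).
    by apply: (char_mx_free (F := R[i]) IK) => //; exact: torus_neq0.
  have [_ max] := buchstaber_max R (universal_complex k.+2).
  apply: leq_trans (max _ fr).
  (* The rank is at least [(4 * 2 ^ k - 1) - (2 ^ k + 1)]. *)
  have := rle; rewrite card_nzvec card_option card_mx card_Fp // mul1n.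
  by rewrite !expnS; have := expn_gt0 2 k; lia.
split=> //; rewrite /Delta.
have := real_buchstaber_universal_le R n.
(* [n < 2 ^ n] makes the truncated subtraction in the real bound exact. *)
have := leq_trans (ltn_expl n (ltnSn 1)) (leqnn _).
have -> : (2 ^ n = 4 * 2 ^ (n - 2))%N by rewrite -[4%N]/(2 ^ 2)%N -expnD subnKC.
move: low; set B := buchstaber _ _; set A := real_buchstaber _ _.
by move: (2 ^ (n - 2))%N => N; clear -hn; lia.
Qed.
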